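(* Let $L^{TV}$ and $L^{TV}_N$ be the expected and empirical total-variation regularized losses $$L^{TV}(u)=\mathbb{E}_{\rho_x}\big(D(u(x),y(x))+|\nabla u(x)|\big),\ u\in U,\qquad L^{TV}_N(\phi)=\frac1N\sum_{i=1}^N\big(D(\phi(x_i),y(x_i))+|\nabla \phi(x_i)|\big),\ \phi\in V,$$ where $x_1,\dots,x_N$ are i.i.d. samples from $\rho_x$ and $V\subset U$. Suppose that $D$ is $\lambda$-Lipschitz in its first argument, i.e. $|D(u_1(x),y(x))-D(u_2(x),y(x))|\le\lambda|u_1(x)-u_2(x)|$ for all $u_1,u_2\in U$ and $x\in\Omega$. Let $\hat u\in U$ be the minimizer of $L^{TV}$ over $U$, let $\hat\phi\in V$ be a $\delta$-minimizer of $L^{TV}$ over $V$, and let $\hat\phi^N\in V$ be a $\delta$-minimizer of $L^{TV}_N$ over $V$. Assume: (A1) (approximation error) there exists $\phi\in V$ with $\|\phi-\hat u\|_{H^1(\rho_x)}^2\le C_1^2\,\|\hat u\|_*^2/m^{\gamma}$; (A2) (quadrature error) for every $0<\epsilon<1$, with probability at least $1-\epsilon$ over the choice of $x_1,\dots,x_N$, $\ \sup_{\phi\in V}|L^{TV}(\phi)-L^{TV}_N(\phi)|\le C_2(V,m,\epsilon)/\sqrt N$. Then: (a) $$0\le L^{TV}(\hat\phi)-L^{TV}(\hat u)\le(\lambda+1)C_1\frac{\|\hat u\|_*}{m^{\gamma/2}}+\delta .$$ (b) For every $0<\epsilon<1$, with probability at least $1-\epsilon$ over the choice of $x_1,\dots,x_N$,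 $$0\le L^{TV}(\hat\phi^N)-L^{TV}(\hat u)\le(\lambda+1)C_1\frac{\|\hat u\|_*}{m^{\gamma/2}}+\frac{2C_2(V,m,\epsilon)}{\sqrt N}+2\delta .$$
   Context: $\Omega\subset\mathbb{R}^d$ is a bounded domain, $\rho_x$ a probability distribution on $\Omega$, $y$ a given target function on $\Omega$, and $D(\cdot,\cdot)$ a real-valued data-fitting loss. $U$ is a function space of functions $u:\Omega\to\mathbb{R}^n$ ($n\ge1$) for which the gradient is defined and the expectations in the loss are well defined and finite. $V\subset U$ is a set (of neural networks with finitely many parameters). $|\cdot|$ is the Euclidean norm (of vectors, and of the gradient/Jacobian viewed as a vector). The norm is $\|v\|_{H^1(\rho_x)}^2:=\mathbb{E}_{\rho_x}(|v|^2+|\nabla v|^2)$. $\|\cdot\|_*$ is the norm of some given space containing $\hat u$; $C_1\geq 0$ is a constant, $m>0$ is a constant (related to the number of parameters of the networks in $V$), $\gamma$ is a constant order, and $C_2(V,m,\epsilon)$ is a constant depending on $V,m,\epsilon$ (and possibly other factors such as $d$), but not on the sample. For a functional $L$ on a set $W$ and $\delta\ge0$, $\hat w\in W$ is a $\delta$-minimizer of $L$ over $W$ if $L(\hat w)\le\inf_{w\in W}L(w)+\delta$. *)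

(* Defs.v *)
From HB Require Import structures.
From mathcomp Require Import all_boot all_order all_algebra.
From mathcomp Require Import all_classical all_reals all_analysis.
Import Order.TTheory GRing.Theory Num.Theory.
Import numFieldNormedType.Exports.

Set Implicit Arguments.
Unset Strict Implicit.
Unset Printing Implicit Defensive.

Local Open Scope classical_set_scope.
Local Open Scope ring_scope.

Definition bounded_domain (R : realType) (d : nat) (Omega : set 'rV[R]_d) :=
  [/\ open Omega, connected Omega, Omega !=set0 & bounded_set Omega].

(* 'rV[R]_d carries no canonical measurable structure; this copy of it is
   equipped with the Borel sigma-algebra. *)
Definition borel_rV (R : realType) (d : nat) :=
  g_sigma_algebraType (@open 'rV[R]_d).

(* The library norm of a matrix is the max norm, hence the explicit
   Euclidean (Frobenius) norm. *)
Definition enorm (R : realType) (p q : nat) (A : 'M[R]_(p, q)) : R :=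
  Num.sqrt (\sum_i \sum_j A i j ^+ 2).

(* Row j is the partial derivative of u along the j-th coordinate; only
   meaningful at points where all these partial derivatives exist. *)
Definition grad (R : realType) (d n : nat) (u : 'rV[R]_d -> 'rV[R]_n)
    (x : 'rV[R]_d) : 'M[R]_(d, n) :=
  \matrix_(j, i) ('D_(delta_mx 0 j) u x) 0 i.

Section losses.
Variables (R : realType) (d n : nat) (Y : Type).
Variables (Omega : set 'rV[R]_d) (rho : probability (borel_rV R d) R).
Variables (D : 'rV[R]_n -> Y -> R) (y : 'rV[R]_d -> Y).
Implicit Types u v : 'rV[R]_d -> 'rV[R]_n.

Definition tv_integrand u (x : 'rV[R]_d) : R := D (u x) (y x) + enorm (grad u x).

Definition LTV u : R := (\int[rho]_(x in Omega) tv_integrand u x)%R.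

Definition LTV_emp (N : nat) (x : 'I_N -> 'rV[R]_d) u : R :=
  N%:R^-1 * \sum_(i < N) tv_integrand u (x i).

(* Functions are total on R^d, but only their values on the open set Omega
   matter.  The partial derivatives are required to exist only almost
   everywhere, so that e.g. piecewise linear networks are not excluded. *)
Record admissible u : Prop := Admissible {
  admissible_measurable : forall i,
    measurable_fun (Omega : set (borel_rV R d))
      (fun x : borel_rV R d => u x 0 i);
  admissible_derivable :
    {ae rho, forall x, Omega x -> forall j : 'I_d, derivable u x (delta_mx 0 j)};
  admissible_grad_measurable : forall j i,
    measurable_fun (Omega : set (borel_rV R d))
      (fun x : borel_rV R d => grad u x j i);
  admissible_integrable :
    rho.-integrable (Omega : set (borel_rV R d)) (EFin \o tv_integrand u) }.

(* Extended-real valued: it is +oo when v is not in H^1(rho). *)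
Definition H1norm_sqr v : \bar R :=
  (\int[rho]_(x in Omega) (enorm (v x) ^+ 2 + enorm (grad v x) ^+ 2)%:E)%E.

(* The normed space S consists of (classes of) the functions in F, cls f being
   the class of f.  Which functions are identified (those equal on Omega, those
   equal almost everywhere, ...) is left open, except that the class of f only
   depends on its restriction to Omega. *)
Record function_space (S : normedModType R)
    (F : set ('rV[R]_d -> 'rV[R]_n)) (cls : ('rV[R]_d -> 'rV[R]_n) -> S)
    : Prop := FunctionSpace {
  function_space0 : F (fun=> 0);
  function_spaceP : forall (a : R) f g, F f -> F g ->
    F (fun x => a *: f x + g x) /\
    cls (fun x => a *: f x + g x) = a *: cls f + cls g;
  function_space_restr : forall f g, F f -> F g ->
    (forall x, Omega x -> f x = g x) -> cls f = cls g;
  function_space_surj : forall s, exists2 f, F f & cls f = s }.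

End losses.

Definition delta_minimizer (R : realType) (W : Type) (A : set W) (L : W -> R)
    (delta : R) (w : W) : Prop :=
  A w /\ ((L w)%:E <= ereal_inf [set (L v)%:E | v in A] + delta%:E)%E.

Section probability.
Variables (R : realType) (d d' : measure_display).
Variables (T : measurableType d) (T' : measurableType d').
Variable P : probability T R.

(* The event E itself need not be measurable (it may involve a supremum over
   an uncountable family, or a non-measurable choice of minimizers). *)
Definition with_probability_ge (p : R) (E : set T) : Prop :=
  exists A : set T, [/\ measurable A, A `<=` E & (p%:E <= P A)%E].

Definition mutually_independent (N : nat) (X : 'I_N -> {RV P >-> T'}) : Prop :=
  forall (J : {set 'I_N}) (A : 'I_N -> set T'),
    (forall i, measurable (A i)) ->
    P [set w | forall i, i \in J -> A i (X i w)] =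
      (\prod_(i in J) P (X i @^-1` A i))%E.

Definition iid (rho : probability T' R) (N : nat) (X : 'I_N -> {RV P >-> T'})
    : Prop :=
  mutually_independent X /\
  forall i (A : set T'), measurable A -> distribution P (X i) A = rho A.

End probability.

(* Main.v *)
(* The pointwise bound
   D(u, y) - D(v, y) + |grad u| - |grad v| <= lambda |u - v| + |grad (u - v)|
   and the inequality 2 a <= a^2 / t + t give, for every t > 0,
   L(u) - L(v) <= (lambda + 1) / 2 * (||u - v||_{H^1}^2 / t + t),
   and optimizing t yields L(u) - L(v) <= (lambda + 1) ||u - v||_{H^1}.
   Applied to the approximant phi of (A1) and uhat, this bounds
   L(phi) - L(uhat); part (a) costs an extra delta for comparing phihat with
   phi, and part (b) two more quadrature errors for passing from L to L_N at
   phihatN and back at phi. *)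

Require Import Defs.
From mathcomp Require Import all_boot all_order all_algebra.
From mathcomp Require Import all_classical all_reals all_analysis.
From mathcomp Require Import measurable_realfun ring lra.
Import Order.TTheory GRing.Theory Num.Theory.
Import numFieldNormedType.Exports.

Local Open Scope classical_set_scope.
Local Open Scope ring_scope.

(** * Euclidean norm inequalities *)

Lemma sqr_sum_ge0 {R : realDomainType} {I : finType} (f : I -> R) :
  0 <= \sum_i f i ^+ 2.
Proof. by apply: sumr_ge0 => i _; exact: sqr_ge0. Qed.

(** With [p] and [q] the two norms, expanding the sum of the squares [(q * a i - p * b i) ^+ 2]
    gives a nonnegative multiple of [p * q], which can be divided out. If [p] or [q] is 0, one
    family vanishes. *)
Lemma cauchy_schwarz_sum {R : rcfType} {I : finType} (a b : I -> R) :
  \sum_i a i * b i <=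
  Num.sqrt (\sum_i a i ^+ 2) * Num.sqrt (\sum_i b i ^+ 2).
Proof.
have sqrt_sum0 (f : I -> R) :
    Num.sqrt (\sum_i f i ^+ 2) = 0 -> forall i, f i = 0.
  move=> /eqP; rewrite sqrtr_eq0 => f_le0 i.
  have /psumr_eq0P f0 : \sum_i f i ^+ 2 = 0.
    by apply/eqP; rewrite eq_le f_le0 sqr_sum_ge0.
  by apply/eqP; rewrite -sqrf_eq0; apply/eqP/f0 => // j _; exact: sqr_ge0.
set p := Num.sqrt (\sum_i a i ^+ 2); set q := Num.sqrt (\sum_i b i ^+ 2).
have [p0|p_neq0] := eqVneq p 0.
  by rewrite p0 mul0r big1// => i _; rewrite (sqrt_sum0 _ p0) mul0r.
have [q0|q_neq0] := eqVneq q 0.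
  by rewrite q0 mulr0 big1// => i _; rewrite (sqrt_sum0 _ q0) mulr0.
have pq_gt0 : 0 < p * q by rewrite mulr_gt0// lt0r ?p_neq0 ?q_neq0 sqrtr_ge0.
have := sqr_sum_ge0 (fun i => q * a i - p * b i).
have -> : \sum_i (q * a i - p * b i) ^+ 2 =
    q ^+ 2 * (\sum_i a i ^+ 2) + p ^+ 2 * (\sum_i b i ^+ 2)
    - 2 * (p * q) * (\sum_i a i * b i).
  by rewrite !mulr_sumr -big_split -sumrB /=; apply: eq_bigr => i _; ring.
rewrite -[\sum_i a i ^+ 2]sqr_sqrtr ?sqr_sum_ge0// -/p.
rewrite -[\sum_i b i ^+ 2]sqr_sqrtr ?sqr_sum_ge0// -/q => h.
by rewrite -(ler_pM2l pq_gt0); nra.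
Qed.

Lemma ler_sqrt_sumD {R : rcfType} {I : finType} (a b : I -> R) :
  Num.sqrt (\sum_i (a i + b i) ^+ 2) <=
  Num.sqrt (\sum_i a i ^+ 2) + Num.sqrt (\sum_i b i ^+ 2).
Proof.
rewrite -(ger0_norm (addr_ge0 (sqrtr_ge0 _) (sqrtr_ge0 _))) -sqrtr_sqr.
rewrite ler_wsqrtr// sqrrD !sqr_sqrtr ?sqr_sum_ge0//.
have -> : \sum_i (a i + b i) ^+ 2 =
    \sum_i a i ^+ 2 + (\sum_i a i * b i) *+ 2 + \sum_i b i ^+ 2.
  by rewrite -sumrMnl -!big_split; apply: eq_bigr => i _; rewrite sqrrD.
by rewrite lerD2r lerD2l lerMn2r cauchy_schwarz_sum.
Qed.

Lemma enormD {R : realType} {p q} (A B : 'M[R]_(p, q)) :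
  enorm (A + B) <= enorm A + enorm B.
Proof.
(* A matrix becomes one vector indexed by pairs, so the vector triangle inequality applies. *)
rewrite /enorm !pair_bigA /=.
under eq_bigr do rewrite mxE.
exact: ler_sqrt_sumD.
Qed.

Lemma sqr_enorm {R : realType} {p q} (A : 'M[R]_(p, q)) :
  enorm A ^+ 2 = \sum_i \sum_j A i j ^+ 2.
Proof. by rewrite /enorm pair_bigA sqr_sqrtr ?sqr_sum_ge0. Qed.

(** * Integration and gradients *)

(* The integral of a nonnegative function, measurable or not, is a supremum over
   the simple functions below it. *)
Lemma ge0_subset_le_integral {d} {T : measurableType d} {R : realType}
    (mu : {measure set T -> \bar R}) (A B : set T) (f g : T -> \bar R) :
  A `<=` B -> (forall x, A x -> (0 <= f x <= g x)%E) ->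
  (forall x, B x -> (0 <= g x)%E) ->
  (\int[mu]_(x in A) f x <= \int[mu]_(x in B) g x)%E.
Proof.
move=> AB fg g0.
have f0 x : A x -> (0 <= f x)%E by move=> /fg/andP[].
rewrite !ge0_integralE//; apply: le_ereal_sup => _ [h hf <-].
exists h => //= x; apply: le_trans (hf x) _.
(* Outside [A] the extension of [f] is 0, so nonnegativity of [g] on [B] is enough there. *)
rewrite !patchE; have [xA|xA] := boolP (x \in A).
  by rewrite mem_set; [case/andP: (fg x (set_mem xA))|exact/AB/set_mem].
by case: ifPn => // /set_mem/g0.
Qed.

Lemma Rintegral_sub_le_affine {d} {T : measurableType d} {R : realType}
    (mu : {finite_measure set T -> \bar R}) (A : set T) (f g h : T -> R)
    (a b : R) : measurable A ->
  mu.-integrable A (EFin \o f) -> mu.-integrable A (EFin \o g) ->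
  mu.-integrable A (EFin \o h) ->
  (forall x, A x -> f x - g x <= a * h x + b) ->
  \int[mu]_(x in A) f x - \int[mu]_(x in A) g x <=
  a * \int[mu]_(x in A) h x + b * fine (mu A).
Proof.
move=> mA intf intg inth fgh.
have int_ah : mu.-integrable A (EFin \o (fun x => a * h x)).
  exact: (integrableZl mA a inth).
have int_b : mu.-integrable A (EFin \o cst b).
  exact: finite_measure_integrable_cst.
rewrite -RintegralB// -RintegralZl// -Rintegral_cst// -RintegralD//.
apply: le_Rintegral => //;
  [exact: (integrableB mA intf intg)|exact: (integrableD mA int_ah int_b)].
Qed.

Lemma gradB {R : realType} {d n} (u v : 'rV[R]_d -> 'rV[R]_n) x :
  (forall j, derivable u x (delta_mx 0 j)) ->
  (forall j, derivable v x (delta_mx 0 j)) ->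
  grad (fun z => u z - v z) x = grad u x - grad v x.
Proof.
move=> du dv; apply/matrixP => j i; rewrite !mxE.
by rewrite (deriveB (du j) (dv j)) !mxE.
Qed.

Lemma measurable_sqr_enorm {d} {T : measurableType d} {R : realType} {p q}
    (A : set T) (f : T -> 'M[R]_(p, q)) : measurable A ->
  (forall i j, measurable_fun A (fun x => f x i j)) ->
  measurable_fun A (fun x => enorm (f x) ^+ 2).
Proof.
move=> mA mf; under eq_fun do rewrite sqr_enorm.
apply: measurable_sum => // i; apply: measurable_sum => // j.
exact: measurable_funM.
Qed.

(** * Loss difference against the H^1 norm *)

Lemma ler_linear_AMGM {R : realFieldType} (lambda a b t : R) :
  0 <= lambda -> 0 < t ->
  lambda * a + b <= (lambda + 1) / 2 * ((a ^+ 2 + b ^+ 2) / t + t).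
Proof.
move=> lambda_ge0 t_gt0; have t_neq0 := lt0r_neq0 t_gt0.
set w := (a ^+ 2 + b ^+ 2) / t + t.
have w_t : w * t = a ^+ 2 + b ^+ 2 + t ^+ 2 by rewrite /w; field.
(* Here [w * t - 2 * a * t] is [(a - t) ^+ 2 + b ^+ 2], and symmetrically for [b]. Both terms are
   thus at most [w / 2], up to the factor [lambda]. *)
have [aw bw] : 2 * a <= w /\ 2 * b <= w.
  have := (sqr_ge0 a, sqr_ge0 b, sqr_ge0 (a - t), sqr_ge0 (b - t)).
  by move=> [[[? ?] ?] ?]; split; rewrite -(ler_pM2r t_gt0) w_t; nra.
by have := ler_wpM2l lambda_ge0 aw; lra.
Qed.

(** The H^1 norm is extended real, so it enters through a real upper bound [s]. One direction
    suffices: minimality of [uhat] gives the other sign. *)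
Lemma LTV_sub_le {R : realType} {d n : nat} {Y : Type} (Omega : set 'rV[R]_d)
    (rho : probability (borel_rV R d) R) (D : 'rV[R]_n -> Y -> R)
    (y : 'rV[R]_d -> Y) (lambda s : R) (u v : 'rV[R]_d -> 'rV[R]_n) :
  open Omega -> 0 <= lambda -> 0 <= s ->
  admissible Omega rho D y u -> admissible Omega rho D y v ->
  (forall x, Omega x ->
    `|D (u x) (y x) - D (v x) (y x)| <= lambda * enorm (u x - v x)) ->
  (H1norm_sqr Omega rho (fun x => (u x - v x)%R) <= (s ^+ 2)%:E)%E ->
  LTV Omega rho D y u - LTV Omega rho D y v <= (lambda + 1) * s.
Proof.
move=> open_Omega lambda_ge0 s_ge0 [mu du mgu iu] [mv dv mgv iv] lipD uv_s.
have mOmega : measurable (Omega : set (borel_rV R d)).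
  exact: sub_sigma_algebra.
(* [grad (u - v)] may fail to be measurable on the null set where [grad] is not
   additive, so that set is removed before integrating. *)
have [Z [mZ Z0 duvZ]] :=
  @filterI _ _ (ae_filter_ringOfSetsType rho) _ _ du dv.
pose Omega' : set (borel_rV R d) := Omega `\` Z.
have mOmega' : measurable Omega' by exact: measurableD.
have subOmega : Omega' `<=` Omega by move=> x [].
have duv x : Omega' x -> (forall j, derivable u x (delta_mx 0 j)) /\
    (forall j, derivable v x (delta_mx 0 j)).
  move=> [Ox nZx]; apply: contrapT => nduv; apply: nZx; apply: duvZ => /=.
  by move=> [h1 h2]; apply: nduv; split; [exact: h1|exact: h2].
have LTV_Omega' w : rho.-integrable (Omega : set (borel_rV R d))
    (EFin \o tv_integrand D y w) ->
    LTV Omega rho D y w = \int[rho]_(x in Omega') tv_integrand D y w x.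
  by move=> iw; rewrite /LTV /Rintegral (negligible_integral mZ mOmega iw Z0).
have integrableS' (f : borel_rV R d -> \bar R) :
    rho.-integrable (Omega : set (borel_rV R d)) f -> rho.-integrable Omega' f.
  exact: integrableS.
pose g x := enorm (u x - v x) ^+ 2 + enorm (grad u x - grad v x) ^+ 2.
have g_ge0 x : 0 <= g x by rewrite addr_ge0 ?sqr_ge0.
have mg : measurable_fun Omega' (g : borel_rV R d -> R).
  apply: (@measurable_funS _ _ _ _ (Omega : set (borel_rV R d))) => //.
  apply: measurable_funD; apply: measurable_sqr_enorm => // i j.
    rewrite (ord1 i); have := measurable_funB (mu j) (mv j).
    by apply: eq_measurable_fun => x _; rewrite /= !mxE.
  have := measurable_funB (mgu i j) (mgv i j).
  by apply: eq_measurable_fun => x _; rewrite /= !mxE.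
(* On [Omega'] the function [g] is the H^1 integrand of [u - v]; the integral over all of [Omega],
   whose integrand may fail to be measurable, still dominates. *)
have int_g_le : (\int[rho]_(x in Omega') (g x)%:E <= (s ^+ 2)%:E)%E.
  apply: le_trans uv_s; apply: ge0_subset_le_integral => // x => [xO|_].
    have [dux dvx] := duv _ xO.
    by rewrite gradB// lexx lee_fin g_ge0.
  by rewrite lee_fin addr_ge0 ?sqr_ge0.
have ig : rho.-integrable Omega' (EFin \o g).
  apply/integrableP; split; first exact/measurable_EFinP.
  under eq_integral do rewrite /= ger0_norm//.
  exact: le_lt_trans int_g_le (ltry _).
have Rint_g_le : \int[rho]_(x in Omega') g x <= s ^+ 2.
  rewrite -lee_fin /Rintegral fineK//; exact: integrable_fin_num.
rewrite (LTV_Omega' u iu) (LTV_Omega' v iv).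
apply/ler_addgt0Pr => e e_gt0.
(* The optimal parameter is [t = s], shifted to stay positive when [s = 0]. *)
have lambda1_gt0 : 0 < lambda + 1 by rewrite ltr_wpDl.
pose t := s + e / (lambda + 1).
have t_gt0 : 0 < t by rewrite ltr_wpDl// divr_gt0.
have int_le := Rintegral_sub_le_affine rho _ _ _ _
  ((lambda + 1) / 2 / t) ((lambda + 1) / 2 * t) mOmega'
  (integrableS' _ iu) (integrableS' _ iv) ig.
apply: le_trans (int_le _) _ => [x [Ox _]|].
  have enorm_sub : enorm (grad u x) - enorm (grad v x) <=
      enorm (grad u x - grad v x).
    by rewrite lerBlDr (le_trans _ (enormD _ _))// subrK.
  rewrite /tv_integrand opprD addrACA.
  apply: le_trans (lerD (le_trans (ler_norm _) (lipD x Ox)) enorm_sub) _.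
  apply: le_trans (ler_linear_AMGM _ _ _ t lambda_ge0 t_gt0) _.
  by rewrite -/(g x) mulrDr lerD2r mulrA mulrAC.
have rho_le1 : fine (rho Omega') <= 1.
  by rewrite -lee_fin fineK ?fin_num_measure// probability_le1.
have c_ge0 : 0 <= (lambda + 1) / 2 by rewrite divr_ge0// ltW.
have lt : (lambda + 1) * t = (lambda + 1) * s + e.
  by rewrite mulrDr mulrCA divff ?mulr1// lt0r_neq0.
(* As [s <= t], [s ^+ 2] is at most [t * s], so the division by [t] cancels. What remains is
   [(lambda + 1) / 2 * (s + t)], at most [(lambda + 1) * t], which is the target by the choice of
   [t]. *)
apply: (@le_trans _ _ ((lambda + 1) / 2 / t * (t * s) + (lambda + 1) / 2 * t)).
  apply: lerD.
    apply: ler_wpM2l; first by rewrite divr_ge0// ltW.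
    apply: le_trans Rint_g_le _; rewrite expr2 ler_wpM2r// lerDl.
    by rewrite divr_ge0// ltW.
  by rewrite ler_piMr// mulr_ge0// ltW.
rewrite mulrA mulfVK ?lt0r_neq0// -mulrDr mulrAC mulrDr lt.
by rewrite ler_pdivrMr// mulr_natr mulr2n lerD2r lerDl ltW.
Qed.

(** * From the loss bound to minimizers *)

Lemma ereal_sup_le_mem {R : realType} {W : Type} (A : set W) (f : W -> R) c w :
  (ereal_sup [set (f v)%:E | v in A] <= c%:E)%E -> A w -> f w <= c.
Proof.
move=> supc Aw; rewrite -lee_fin; apply: le_trans supc.
by apply: ereal_sup_ubound; exists w.
Qed.

Lemma delta_minimizer_le {R : realType} {W : Type} (A : set W) (L : W -> R)
    delta w v : delta_minimizer A L delta w -> A v -> L w <= L v + delta.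
Proof.
move=> [_ infw] Av; rewrite -lee_fin; apply: le_trans infw _.
by rewrite EFinD leeD2r//; apply: ereal_inf_lbound; exists v.
Qed.

(** Matches the squared rate of (A1) with the rate in the conclusion. *)
Lemma powR_half_sqr {R : realType} (m gamma : R) :
  (m `^ (gamma / 2)) ^+ 2 = m `^ gamma.
Proof.
by rewrite -powR_mulrn ?powR_ge0// -powRrM mulfVK// pnatr_eq0.
Qed.

Theorem theorem3 (R : realType) (d n : nat) (hd : (0 < d)%N) (hn : (0 < n)%N)
  (Omega : set 'rV[R]_d) (hOmega : bounded_domain Omega)
  (rho : probability (borel_rV R d) R) (hrho : rho Omega = 1%E)
  (Y : Type) (y : 'rV[R]_d -> Y) (D : 'rV[R]_n -> Y -> R)
  (U V : set ('rV[R]_d -> 'rV[R]_n))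
  (hU : forall u, U u -> admissible Omega rho D y u)
  (hVU : V `<=` U)
  (lambda : R) (hlambda : 0 <= lambda)
  (hD : forall u1 u2, U u1 -> U u2 -> forall x, Omega x ->
     `|D (u1 x) (y x) - D (u2 x) (y x)| <= lambda * enorm (u1 x - u2 x))
  (S : normedModType R) (F : set ('rV[R]_d -> 'rV[R]_n))
  (cls : ('rV[R]_d -> 'rV[R]_n) -> S) (hS : function_space Omega F cls)
  (C1 : R) (hC1 : 0 <= C1) (m : R) (hm : 0 < m) (gamma : R)
  (C2 : set ('rV[R]_d -> 'rV[R]_n) -> R -> R -> R)
  (delta : R) (hdelta : 0 <= delta)
  (dT : measure_display) (T : measurableType dT) (P : probability T R)
  (N : nat) (hN : (0 < N)%N) (X : 'I_N -> {RV P >-> borel_rV R d})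
  (hX : iid rho X) (hXOmega : forall i w, Omega (X i w))
  (uhat : 'rV[R]_d -> 'rV[R]_n) (huhat : U uhat)
  (huhat_min : forall u, U u -> LTV Omega rho D y uhat <= LTV Omega rho D y u)
  (huhatF : F uhat)
  (phihat : 'rV[R]_d -> 'rV[R]_n)
  (hphihat : delta_minimizer V (LTV Omega rho D y) delta phihat)
  (phihatN : T -> ('rV[R]_d -> 'rV[R]_n))
  (hphihatN : forall w,
     delta_minimizer V (LTV_emp D y (fun i => X i w)) delta (phihatN w))
  (A1 : exists2 phi, V phi &
     (H1norm_sqr Omega rho (fun x => phi x - uhat x)%R
        <= (C1 ^+ 2 * `|cls uhat| ^+ 2 / m `^ gamma)%:E)%E)
  (A2 : forall eps : R, 0 < eps < 1 ->
     with_probability_ge P (1 - eps)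
       [set w | (ereal_sup [set `|LTV Omega rho D y phi
                                  - LTV_emp D y (fun i => X i w) phi|%:E
                           | phi in V]
                 <= (C2 V m eps / Num.sqrt N%:R)%:E)%E]) :
  (0 <= LTV Omega rho D y phihat - LTV Omega rho D y uhat
     <= (lambda + 1) * C1 * (`|cls uhat| / m `^ (gamma / 2)) + delta)
  /\
  (forall eps : R, 0 < eps < 1 ->
     with_probability_ge P (1 - eps)
       [set w | 0 <= LTV Omega rho D y (phihatN w) - LTV Omega rho D y uhat
                  <= (lambda + 1) * C1 * (`|cls uhat| / m `^ (gamma / 2))
                     + 2 * C2 V m eps / Num.sqrt N%:R + 2 * delta]).
Proof.
have [phi Vphi phi_H1] := A1.
have opO : open Omega by case: hOmega.
set B := (lambda + 1) * C1 * (`|cls uhat| / m `^ (gamma / 2)).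
have approx : LTV Omega rho D y phi - LTV Omega rho D y uhat <= B.
  (* Here [s] is [C1] times the rate, whose square is the bound of (A1). *)
  rewrite /B -mulrA; apply: LTV_sub_le => //.
  - by rewrite mulr_ge0// divr_ge0// powR_ge0.
  - exact: hU (hVU _ Vphi).
  - exact: hU.
  - by move=> x; apply: hD => //; exact: hVU.
  - by rewrite !exprMn exprVn powR_half_sqr mulrA.
split.
  have Vphihat : V phihat by case: hphihat.
  rewrite subr_ge0 huhat_min//=; last exact: hVU.
  rewrite lerBlDr (le_trans (delta_minimizer_le _ _ _ _ _ hphihat Vphi))//.
  by rewrite addrAC lerD2r -lerBlDr.
move=> eps eps01; have [A [mA AE PA]] := A2 eps eps01.
(* The event of (A2) for the same [eps] serves: on it the argument is deterministic. Uniformity over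
   [V] matters, since [phihatN w] depends on the sample. *)
exists A; split=> // w /AE /= quad.
have VphihatN : V (phihatN w) by case: (hphihatN w).
rewrite subr_ge0 huhat_min//=; last exact: hVU.
have := ereal_sup_le_mem _ _ _ _ quad VphihatN.
have := ereal_sup_le_mem _ _ _ _ quad Vphi.
have := delta_minimizer_le _ _ _ _ _ (hphihatN w) Vphi.
rewrite -mulrA; move: approx hdelta; rewrite !ler_norml.
(* With [c] the quadrature bound, the chain is L(phihatN) <= L_N(phihatN) + c <= L_N(phi) + delta +
   c <= L(phi) + delta + 2c, then [approx]. A single [delta] is spent; [hdelta] allows for the
   second. *)
move: (LTV _ _ _ _ _) (LTV _ _ _ _ _) (LTV _ _ _ _ _) (LTV_emp _ _ _ _)
  (LTV_emp _ _ _ _) (C2 _ _ _ / _) B => l1 l2 l3 l4 l5 c B'.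
clear; move=> h1 h2 h3 /andP[h4 h5] /andP[h6 h7]; lra.
Qed.
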